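(* Let $(\Omega,\mathscr{H},\widehat{E})$ be a sub-linear expectation space with conjugate expectation $\widehat{\mathcal{E}}$ and upper capacity $\mathbb{V}$, let $\{X_n;n\geq1\}\subset\mathscr{H}$ be a sequence of independent random variables in $(\Omega,\mathscr{H},\widehat{E})$, and suppose $\mathbb{V}$ is countably sub-additive. For a random variable $X$ and a constant $c>0$ write $X^c:=(-c)\vee(X\wedge c)$. If the following three conditions hold for some $c\in(0,+\infty)$: (i) $\sum_{n=1}^{\infty}\mathbb{V}(|X_n|>c)<\infty$; (ii) $\sum_{n=1}^{\infty}\widehat{E}[X_n^c]$ and $\sum_{n=1}^{\infty}\widehat{\mathcal{E}}[X_n^c]$ both converge; (iii) $\sum_{n=1}^{\infty}\widehat{E}[|X_n^c|^q]<\infty$ for some $1\leq q\leq 2$; then $\sum_{n=1}^{\infty}X_n$ converges almost surely in capacity (a.s. $\mathbb{V}$).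
   Context: Let $(\Omega,\mathcal{F})$ be a measurable space and let $\mathscr{H}$ be a linear space of real ($\mathcal{F}$-measurable) functions on $\Omega$ such that $X_1,\ldots,X_n\in\mathscr{H}$ implies $\varphi(X_1,\ldots,X_n)\in\mathscr{H}$ for every $\varphi\in C_{l,Lip}(\mathbb{R}^n)$. Here $C_{l,Lip}(\mathbb{R}^n)$ is the linear space of functions $\varphi:\mathbb{R}^n\to\mathbb{R}$ satisfying $|\varphi(x)-\varphi(y)|\leq C(1+|x|^m+|y|^m)|x-y|$ for all $x,y\in\mathbb{R}^n$, for some $C>0$ and $m\in\mathbb{N}$ depending on $\varphi$. Elements of $\mathscr{H}$ are called random variables. A sub-linear expectation on $\mathscr{H}$ is a function $\widehat{E}:\mathscr{H}\to[-\infty,+\infty]$ such that for all $X,Y\in\mathscr{H}$: (a) $X\geq Y$ implies $\widehat{E}[X]\geq\widehat{E}[Y]$; (b) $\widehat{E}[c]=c$ for constants $c$; (c) $\widehat{E}[X+Y]\leq\widehat{E}[X]+\widehat{E}[Y]$ whenever the right-hand side is not of the form $+\infty-\infty$ or $-\infty+\infty$; (d) $\widehat{E}[\lambda X]=\lambda\widehat{E}[X]$ for $\lambda\geq 0$. The triple $(\Omega,\mathscr{H},\widehat{E})$ is called a sub-linear expectation space. The conjugate expectation is $\widehat{\mathcal{E}}[X]:=-\widehat{E}[-X]$. The upper capacity generated by $\widehat{E}$ is $\mathbb{V}(A):=\inf\{\widehat{E}[\xi]: I_A\leq\xi,\ \xi\in\mathscr{H}\}$ for $A\in\mathcal{F}$,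 where $I_A$ is the indicator function of $A$. $\mathbb{V}$ is called countably sub-additive if $\mathbb{V}(\bigcup_{n=1}^{\infty}A_n)\leq\sum_{n=1}^{\infty}\mathbb{V}(A_n)$ for all $A_n\in\mathcal{F}$. A property holds almost surely in capacity (a.s. $\mathbb{V}$) if the set $N\in\mathcal{F}$ where it fails satisfies $\mathbb{V}(N)=0$; convergence of a random series means convergence of its partial sums to a finite limit. Independence: a random vector $\mathbf{Y}=(Y_1,\ldots,Y_n)$ ($Y_i\in\mathscr{H}$) is independent to a random vector $\mathbf{X}=(X_1,\ldots,X_m)$ ($X_i\in\mathscr{H}$) under $\widehat{E}$ if for each $\varphi\in C_{l,Lip}(\mathbb{R}^m\times\mathbb{R}^n)$ one has $\widehat{E}[\varphi(\mathbf{X},\mathbf{Y})]=\widehat{E}\big[\widehat{E}[\varphi(\mathbf{x},\mathbf{Y})]|_{\mathbf{x}=\mathbf{X}}\big]$ whenever $\overline{\varphi}(\mathbf{x}):=\widehat{E}[\varphi(\mathbf{x},\mathbf{Y})]<\infty$ for all $\mathbf{x}$ and $\widehat{E}[|\overline{\varphi}(\mathbf{X})|]<\infty$. A sequence $\{X_n;n\geq1\}$ of random variables is independent if $X_{i+1}$ is independent to $(X_1,\ldots,X_i)$ for each $i\geq 1$. *)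

(* Defs.v *)
From mathcomp Require Import all_boot all_order all_algebra.
From mathcomp Require Import all_classical all_reals all_analysis.

Set Implicit Arguments.
Unset Strict Implicit.
Unset Printing Implicit Defensive.

Import Order.TTheory GRing.Theory Num.Theory.
Import numFieldNormedType.Exports.

Local Open Scope classical_set_scope.
Local Open Scope ring_scope.

(* The library norm on 'rV[R]_n is the sup norm, hence this definition. *)
Definition eucl_norm (R : realType) (n : nat) (x : 'rV[R]_n) : R :=
  Num.sqrt (\sum_(i < n) x ord0 i ^+ 2).

Definition C_lLip (R : realType) (n : nat) (phi : 'rV[R]_n -> R) : Prop :=
  exists C : R, exists m : nat, 0 < C /\
    forall x y : 'rV[R]_n,
      `|phi x - phi y| <=
        C * (1 + eucl_norm x ^+ m + eucl_norm y ^+ m) * eucl_norm (x - y).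

Definition rvec (R : realType) (Omega : Type) (n : nat)
    (X : 'I_n -> Omega -> R) (w : Omega) : 'rV[R]_n :=
  \row_(i < n) X i w.

Record random_variable_space (R : realType) (d : measure_display)
    (Omega : measurableType d) (H : set (Omega -> R)) : Prop := {
  rvs_measurable : forall X, H X -> measurable_fun setT X ;
  rvs_zero : H (fun=> 0) ;
  rvs_linear : forall (a b : R) X Y, H X -> H Y ->
    H (fun w => a * X w + b * Y w) ;
  rvs_C_lLip : forall (n : nat) (X : 'I_n -> Omega -> R) (phi : 'rV[R]_n -> R),
    (forall i, H (X i)) -> C_lLip phi -> H (fun w => phi (rvec X w)) }.

(* E is a total function, but only its values on H are ever constrained or
   used.  [x +? y] excludes exactly the sums +oo - oo and -oo + oo. *)
Record sublinear_expectation (R : realType) (Omega : Type)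
    (H : set (Omega -> R)) (E : (Omega -> R) -> \bar R) : Prop := {
  sle_mono : forall X Y, H X -> H Y ->
    (forall w, Y w <= X w) -> (E Y <= E X)%E ;
  sle_cst : forall c : R, E (fun=> c) = c%:E ;
  sle_subadd : forall X Y, H X -> H Y -> (E X +? E Y)%E ->
    (E (fun w => (X w + Y w)%R) <= E X + E Y)%E ;
  sle_homog : forall (a : R) X, 0 <= a -> H X ->
    E (fun w => (a * X w)%R) = (a%:E * E X)%E }.

Definition sublinear_expectation_space (R : realType) (d : measure_display)
    (Omega : measurableType d) (H : set (Omega -> R))
    (E : (Omega -> R) -> \bar R) : Prop :=
  random_variable_space H /\ sublinear_expectation H E.

Definition conj_expectation (R : realType) (Omega : Type)
    (E : (Omega -> R) -> \bar R) (X : Omega -> R) : \bar R :=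
  (- E (fun w => (- X w)%R))%E.

Definition upper_capacity (R : realType) (Omega : Type)
    (H : set (Omega -> R)) (E : (Omega -> R) -> \bar R)
    (A : set Omega) : \bar R :=
  ereal_inf [set E xi | xi in [set xi | H xi /\
                                        forall w, (\1_A w : R) <= xi w]].

Definition countably_subadditive (R : realType) (d : measure_display)
    (Omega : measurableType d) (V : set Omega -> \bar R) : Prop :=
  forall A : (set Omega)^nat, (forall n, measurable (A n)) ->
    (V (\bigcup_n A n) <= \sum_(0 <= n <oo) V (A n))%E.

Definition almost_surely (R : realType) (d : measure_display)
    (Omega : measurableType d) (V : set Omega -> \bar R)
    (P : Omega -> Prop) : Prop :=
  measurable [set w | ~ P w] /\ V [set w | ~ P w] = 0%E.

(* Y is independent to X.  E is only meaningful on H, so phibar(X) has to be a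
   random variable for E[|phibar(X)|] and E[phibar(X)] to make sense: Z is that
   random variable. *)
Definition independent_to (R : realType) (Omega : Type)
    (H : set (Omega -> R)) (E : (Omega -> R) -> \bar R) (m n : nat)
    (Y : 'I_n -> Omega -> R) (X : 'I_m -> Omega -> R) : Prop :=
  forall phi : 'rV[R]_(m + n) -> R, C_lLip phi ->
    let phibar (x : 'rV[R]_m) : \bar R :=
      E (fun w => phi (row_mx x (rvec Y w))) in
    (forall x, (phibar x < +oo)%E) ->
    forall Z : Omega -> R, H Z ->
      (forall w, phibar (rvec X w) = (Z w)%:E) ->
      (E (fun w => `|Z w|%R) < +oo)%E ->
      E (fun w => phi (row_mx (rvec X w) (rvec Y w))) = E Z.

Definition independent_seq (R : realType) (Omega : Type)
    (H : set (Omega -> R)) (E : (Omega -> R) -> \bar R)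
    (X : nat -> Omega -> R) : Prop :=
  forall k : nat,
    independent_to H E (fun _ : 'I_1 => X k.+1) (fun j : 'I_k.+1 => X j).

Definition truncation (R : realType) (Omega : Type) (c : R)
    (X : Omega -> R) : Omega -> R :=
  fun w => Num.max (- c) (Num.min (X w) c).

(* Convergence of a series of extended reals, to a finite limit. *)
Definition ereal_series_converges (R : realType) (u : nat -> \bar R) : Prop :=
  exists l : R, (\sum_(0 <= k < n) u k)%E @[n --> \oo] --> l%:E.

(* Main.v *)
Require Import Defs.
From mathcomp Require Import all_boot all_order all_algebra.
From mathcomp Require Import all_classical all_reals all_analysis.
From mathcomp Require Import ring lra.

Set Implicit Arguments.
Unset Strict Implicit.

Import Order.TTheory GRing.Theory Num.Theory.
Import numFieldNormedType.Exports.

Local Open Scope classical_set_scope.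
Local Open Scope ring_scope.

(** The truncations [Y n = truncation c (X n)] agree with [X n] for all large
[n] outside a null set, because the capacities of the events [c < `|X n|] are
summable and the Borel-Cantelli lemma ([capacity_lim_sup_set]) needs only
countable sub-additivity. So it is enough that the series of the [Y n]
converges almost surely.

The capacity need not be continuous along increasing unions of events, so a
bound on finitely many partial sums does not pass to all of them. What
suffices ([capacity_not_cvg_series]) is that the events that some partial sum
inside a finite block of indices exceeds [eps] have a capacity that is small
uniformly in the length of the block: one then cuts the integers into
consecutive blocks, the [p]-th of which has a partial sum above [1 / 2 ^ p.+1]
with capacity at most [1 / 2 ^ p.+1], and applies Borel-Cantelli to these
events.

The finite maximal inequality is [capacity_block_le]. Independence runs from
the past to the future, so that the quantity which can be controlled is the
largest sum over a terminal segment of the block, rather than over an initial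
one. With increments [g j], the walk [W j.+1 = max 0 (W j + g j)] reflected at
0 dominates all terminal sums, and [W j.+1 ^ 2 <= W j ^ 2 + 2 W j g j + g j ^
2]. If [g j] has expectation 0, independence makes the cross term vanish:
since [W j >= 0], freezing the past gives expectation [W j * 0].
Sub-additivity then bounds the expectation of the square of the walk by the
sum of those of the squared increments ([expectation_reflected_walk_sqr]).

Since [E (- Y n)] is not [- E (Y n)] in general, [Y n] and [- Y n] are centred
separately: the terminal sums are bounded above by a walk with increments [Y n
- E (Y n)] and below by minus the walk with increments [- Y n - E (- Y n)], up
to the sums of the centring constants. The series of the expectations and of
the conjugate expectations converge, so both families of centring constants
have negligible block sums. The second moments are summable, because those of
order [q] are and [Y n ^ 2 <= c ^ (2 - q) |Y n| ^ q]; centring costs a factor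
4 at most ([centered_sqr_le]).

Everything is applied to bounded variables, namely bounded Lipschitz
functionals of finitely many of the [X n]. This makes all expectations finite
and all test functions admissible in the definition of independence. *)

(** * Bounded Lipschitz functionals of a sequence *)

(** Working with functionals of sequences, for the l1 distance, lets functionals
of different numbers of variables be combined without reindexing rows. *)
Definition lip_functional (R : realType) (N : nat) (f : (nat -> R) -> R) : Prop :=
  exists K : R, [/\ 0 <= K, forall u, `|f u| <= K &
    forall u v, `|f u - f v| <= K * \sum_(j < N) `|u j - v j|].

Section LipFunctionals.
Context {R : realType}.
Implicit Types (f g : (nat -> R) -> R) (N : nat).

Let l1_ge0 N (u v : nat -> R) : 0 <= \sum_(j < N) `|u j - v j|.
Proof. by apply: sumr_ge0. Qed.

Lemma lip_functional_cst N (a : R) : lip_functional N (fun=> a).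
Proof.
exists `|a|; split=> // u v; by rewrite subrr normr0 mulr_ge0.
Qed.

Lemma lip_functional_widen N M f : (N <= M)%N ->
  lip_functional N f -> lip_functional M f.
Proof.
move=> NM [K [K0 fK fL]]; exists K; split=> // u v.
apply: le_trans (fL u v) _; apply: ler_wpM2l => //.
rewrite -!(big_mkord xpredT (fun j => `|u j - v j|)) (big_cat_nat (leq0n N) NM) //=.
by rewrite lerDl sumr_ge0.
Qed.

Lemma lip_functionalD N f g : lip_functional N f -> lip_functional N g ->
  lip_functional N (fun u => f u + g u).
Proof.
move=> [K [K0 fK fL]] [L [L0 gL gLL]]; exists (K + L); split.
- exact: addr_ge0.
- by move=> u; apply: le_trans (ler_normD _ _) _; exact: lerD.
- move=> u v; rewrite mulrDl opprD addrACA.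
  by apply: le_trans (ler_normD _ _) _; exact: lerD.
Qed.

Lemma lip_functionalM N f g : lip_functional N f -> lip_functional N g ->
  lip_functional N (fun u => f u * g u).
Proof.
move=> [K [K0 fK fL]] [L [L0 gL gLL]]; exists (K * L + K * L); split.
- by rewrite addr_ge0 ?mulr_ge0.
- move=> u; rewrite normrM; apply: (@le_trans _ _ (K * L)).
    exact: ler_pM.
  by rewrite lerDl mulr_ge0.
- move=> u v.
  have -> : f u * g u - f v * g v = f u * (g u - g v) + (f u - f v) * g v.
    by ring.
  apply: le_trans (ler_normD _ _) _; rewrite !normrM mulrDl; apply: lerD.
    by rewrite -mulrA; apply: ler_pM.
  by rewrite -mulrA (mulrC L) mulrA; apply: ler_pM.
Qed.

Lemma lip_functionalN N f : lip_functional N f ->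
  lip_functional N (fun u => - f u).
Proof.
move=> fN; have -> : (fun u => - f u) = (fun u => (-1) * f u).
  by apply/funext => u; rewrite mulN1r.
by apply: lip_functionalM => //; exact: lip_functional_cst.
Qed.

Lemma lip_functional_max0 N f : lip_functional N f ->
  lip_functional N (fun u => Num.max 0 (f u)).
Proof.
move=> [K [K0 fK fL]]; exists K; split=> //.
  move=> u; apply: le_trans (fK u).
  by case: (leP 0 (f u)); rewrite ?normr0.
move=> u v; apply: le_trans (fL u v).
have H (a b : R) : a - b <= `|a - b| /\ b - a <= `|a - b|.
  by rewrite ler_norm -opprB -normrN ler_norm.
have [h1 h2] := H (f u) (f v).
by rewrite ler_norml; case: (leP 0 (f u)); case: (leP 0 (f v)) => a b;
  apply/andP; split; lra.
Qed.

Lemma lip_functional_local N f (u v : nat -> R) : lip_functional N f ->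
  (forall j, (j < N)%N -> u j = v j) -> f u = f v.
Proof.
move=> [K [_ _ fL]] uv; apply/eqP; rewrite -subr_eq0 -normr_le0.
apply: le_trans (fL u v) _; rewrite big1 ?mulr0// => j _.
by rewrite uv ?subrr ?normr0.
Qed.

Definition seq_of_row N (v : 'rV[R]_N) (j : nat) : R :=
  if insub j is Some i then v ord0 i else 0.

Lemma seq_of_rowE N (v : 'rV[R]_N) (i : 'I_N) : seq_of_row v i = v ord0 i.
Proof. by rewrite /seq_of_row valK. Qed.

Lemma abs_le_eucl_norm N (v : 'rV[R]_N) i : `|v ord0 i| <= eucl_norm v.
Proof.
rewrite /eucl_norm -sqrtr_sqr ler_wsqrtr// (bigD1 i)//= lerDl.
by apply: sumr_ge0 => j _; exact: sqr_ge0.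
Qed.

Lemma lip_functional_C_lLip N f : lip_functional N f ->
  C_lLip (fun v : 'rV[R]_N => f (seq_of_row v)).
Proof.
move=> [K [K0 fK fL]]; exists (K * N%:R + 1), 0%N; split.
  by rewrite ltr_wpDl// mulr_ge0.
move=> x y; apply: le_trans (fL _ _) _.
have e0 : 0 <= eucl_norm (x - y) by exact: sqrtr_ge0.
apply: (@le_trans _ _ (K * (N%:R * eucl_norm (x - y)))).
  apply: ler_wpM2l => //.
  rewrite mulr_natl -[X in _ *+ X]card_ord -sumr_const.
  apply: ler_sum => i _; rewrite !seq_of_rowE.
  by have := abs_le_eucl_norm (x - y) i; rewrite !mxE.
rewrite mulrA ler_wpM2r// !expr0.
have : 0 <= K * N%:R by rewrite mulr_ge0.
lra.
Qed.

Lemma truncation_idE (c x : R) : 0 < c ->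
  truncation c id x = if x < - c then - c else if x <= c then x else c.
Proof.
move=> c0; rewrite /truncation /=.
case: (leP x c) => xc; case: (ltP x (- c)) => cx //.
- by lra.
- by rewrite max_r//; lra.
Qed.

Lemma truncation_id_bound (c x : R) : 0 < c -> `|truncation c id x| <= c.
Proof.
move=> c0; rewrite truncation_idE// ler_norml.
by case: (ltP x) => a; [|case: (leP x) => b]; apply/andP; split; lra.
Qed.

Lemma truncation_id_lip (c x y : R) : 0 < c ->
  `|truncation c id x - truncation c id y| <= `|x - y|.
Proof.
move=> c0.
have h1 : x - y <= `|x - y| by exact: ler_norm.
have h2 : y - x <= `|x - y| by rewrite distrC ler_norm.
have h3 := normr_ge0 (x - y).
rewrite !truncation_idE// ler_norml.
by case: (ltP x) => a; [|case: (leP x) => b];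
  (case: (ltP y) => a'; [|case: (leP y) => b']);
  apply/andP; split; lra.
Qed.

Lemma lip_functional_clip (c : R) n : 0 < c ->
  lip_functional n.+1 (fun u => truncation c id (u n)).
Proof.
move=> c0; exists (Num.max 1 c); split.
- by rewrite le_max ler01.
- by move=> u; rewrite le_max truncation_id_bound// orbT.
- move=> u v; apply: (@le_trans _ _ `|u n - v n|); last first.
    rewrite big_ord_recr/=; apply: (@le_trans _ _ (1 * `|u n - v n|)).
      by rewrite mul1r.
    apply: ler_pM => //; first by rewrite le_max lexx.
    by rewrite lerDr sumr_ge0.
  exact: truncation_id_lip.
Qed.

(** With [t = q - 1] in [[0, 1]], the case [y <= x] reads
[x x^t - y y^t <= (x^t + y^t) (x - y)], that is [y x^t <= x y^t], or
[y^(1-t) <= x^(1-t)]. *)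
Lemma powR_lip (c q x y : R) : 1 <= q <= 2 -> 0 <= x <= c -> 0 <= y <= c ->
  `|x `^ q - y `^ q| <= 2 * c `^ (q - 1) * `|x - y|.
Proof.
move=> /andP[q1 q2].
wlog xy : x y / y <= x.
  move=> W xc yc; case: (leP y x) => [|/ltW] h; first exact: W.
  by rewrite distrC (distrC x); exact: W.
move=> /andP[x0 xc] /andP[y0 yc].
have t0 : 0 <= q - 1 by rewrite subr_ge0.
have q0 : 0 < q by lra.
have mono a b : 0 <= a -> a <= b -> a `^ (q - 1) <= b `^ (q - 1).
  by move=> a0 ab; apply: ge0_ler_powR => //; rewrite nnegrE// (le_trans a0).
rewrite -(mulr_powRB1 x0 q0) -(mulr_powRB1 y0 q0).
have cross : y * x `^ (q - 1) <= x * y `^ (q - 1).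
  have [->|yn0] := eqVneq y 0; first by rewrite mul0r mulr_ge0 ?powR_ge0.
  have yp : 0 < y by rewrite lt_neqAle eq_sym yn0.
  have xp : 0 < x by exact: lt_le_trans xy.
  have E z : 0 < z -> z = z `^ (q - 1) * z `^ (2 - q).
    move=> z0; rewrite -powRD; last by rewrite (gt_eqF z0) implybT.
    by rewrite (_ : q - 1 + (2 - q) = 1) ?powRr1 ?ltW//; ring.
  have -> : y * x `^ (q - 1) = y `^ (q - 1) * x `^ (q - 1) * y `^ (2 - q).
    by rewrite mulrAC -E.
  have -> : x * y `^ (q - 1) = y `^ (q - 1) * x `^ (q - 1) * x `^ (2 - q).
    by rewrite -mulrA -E// mulrC.
  apply: ler_wpM2l; first by rewrite mulr_ge0 ?powR_ge0.
  by apply: ge0_ler_powR; rewrite ?nnegrE//; lra.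
have pos : y * y `^ (q - 1) <= x * x `^ (q - 1).
  by apply: ler_pM => //; rewrite ?powR_ge0// mono.
rewrite !ger0_norm ?subr_ge0//.
have h1 := mono _ _ x0 xc; have h2 := mono _ _ y0 yc.
have : (x `^ (q - 1) + y `^ (q - 1)) * (x - y) <= 2 * c `^ (q - 1) * (x - y).
  by apply: ler_wpM2r; lra.
move: cross; set a := x `^ _; set b := y `^ _ => cross; lra.
Qed.

Lemma lip_functional_clip_powR (c q : R) n : 0 < c -> 1 <= q <= 2 ->
  lip_functional n.+1 (fun u => `|truncation c id (u n)| `^ q).
Proof.
move=> c0 q12; have q0 : 0 <= q by case/andP: q12; lra.
have cc (u : nat -> R) : 0 <= `|truncation c id (u n)| <= c.
  by rewrite normr_ge0 truncation_id_bound.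
have [L [L0 _ gL]] := lip_functional_clip n c0.
have k0 : 0 <= 2 * c `^ (q - 1) by rewrite mulr_ge0 ?powR_ge0.
set k := 2 * _ in k0.
exists (c `^ q + k * L); split.
- by apply: addr_ge0; [exact: powR_ge0|exact: mulr_ge0].
- move=> u; rewrite ger0_norm ?powR_ge0//.
  apply: (@le_trans _ _ (c `^ q)); last by rewrite lerDl mulr_ge0.
  by apply: ge0_ler_powR; rewrite ?nnegrE ?(ltW c0)//; case/andP: (cc u).
- move=> u v; apply: le_trans (powR_lip q12 (cc u) (cc v)) _.
  apply: (@le_trans _ _ (k * (L * \sum_(j < n.+1) `|u j - v j|))).
    apply: ler_wpM2l => //; apply: le_trans (gL u v).
    exact: ler_dist_dist.
  by rewrite mulrA ler_wpM2r// lerDr powR_ge0.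
Qed.

End LipFunctionals.

(** * Sub-linear expectations *)

Section SublinearExpectation.
Context {R : realType} {d : measure_display} {Omega : measurableType d}.
Variables (H : set (Omega -> R)) (E : (Omega -> R) -> \bar R).
Hypotheses (rvs : random_variable_space H) (sle : sublinear_expectation H E).
Implicit Types X Y : Omega -> R.

Lemma rv_functional (N : nat) (f : (nat -> R) -> R) (X : nat -> Omega -> R) :
  (forall n, H (X n)) -> lip_functional N f ->
  H (fun w => f (fun j => X j w)).
Proof.
move=> HX fN.
rewrite (_ : (fun w => _) = (fun w => f (seq_of_row (rvec (fun i : 'I_N => X i) w)))).
  exact: (rvs_C_lLip rvs) (lip_functional_C_lLip fN).
apply/funext => w; apply: (lip_functional_local fN) => j jN.
by rewrite (seq_of_rowE _ (Ordinal jN)) mxE.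
Qed.

Lemma rv_cst (a : R) : H (fun=> a).
Proof.
apply: (@rv_functional 0 (fun=> a) (fun _ _ => 0)) => [_|].
  exact: rvs_zero.
exact: lip_functional_cst.
Qed.

Lemma rvD X Y : H X -> H Y -> H (fun w => X w + Y w).
Proof.
move=> HX HY; have := rvs_linear rvs 1 1 HX HY.
by under eq_fun do rewrite !mul1r.
Qed.

Lemma rvZ (a : R) X : H X -> H (fun w => a * X w).
Proof.
move=> HX; have := rvs_linear rvs a 0 HX HX.
by under eq_fun do rewrite mul0r addr0.
Qed.

Lemma rvN X : H X -> H (fun w => - X w).
Proof. by move=> /(rvZ (-1)); under eq_fun do rewrite mulN1r. Qed.

Lemma expectation_fin_num (M : R) X : H X -> (forall w, `|X w| <= M) ->
  E X \is a fin_num.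
Proof.
move=> HX XM; rewrite fin_numElt; apply/andP; split.
  apply: (@lt_le_trans _ _ (E (fun=> - M))).
    by rewrite (sle_cst sle) ltNyr.
  apply: (sle_mono sle) => // [|w]; first exact: rv_cst.
  by have := XM w; rewrite ler_norml => /andP[].
apply: (@le_lt_trans _ _ (E (fun=> M))).
  apply: (sle_mono sle) => // [|w]; first exact: rv_cst.
  by have := XM w; rewrite ler_norml => /andP[].
by rewrite (sle_cst sle) ltry.
Qed.

Lemma expectation_functional_fin_num N f (X : nat -> Omega -> R) :
  (forall n, H (X n)) -> lip_functional N f ->
  E (fun w => f (fun j => X j w)) \is a fin_num.
Proof.
move=> HX fN; have [K [_ fK _]] := fN.
by apply: (@expectation_fin_num K) => [|w //]; exact: rv_functional fN.
Qed.

Lemma expectation_ge0 X : H X -> (forall w, 0 <= X w) -> (0 <= E X)%E.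
Proof.
move=> HX X0; have <- : E (fun=> 0) = 0%E by exact: (sle_cst sle). 
apply: (sle_mono sle) => //.
exact: rv_cst.
Qed.

Lemma expectation_subadd X Y : H X -> H Y ->
  E X \is a fin_num -> (E (fun w => (X w + Y w)%R) <= E X + E Y)%E.
Proof.
by move=> HX HY fX; apply: (sle_subadd sle) => //; exact: fin_num_adde_defr.
Qed.

Lemma expectation_shift (a : R) X : H X -> E X \is a fin_num ->
  E (fun w => X w + a) = (E X + a%:E)%E.
Proof.
move=> HX fX; apply/eqP; rewrite eq_le -[X in (_ <= _ + X)%E](sle_cst sle a).
rewrite expectation_subadd//=; last exact: rv_cst.
rewrite -leeBrDr// -EFinN -(sle_cst sle (- a)) addeC.
have -> : E X = E (fun w => - a + (X w + a)).
  by congr E; apply/funext => w; ring.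
apply: expectation_subadd; rewrite ?(sle_cst sle)//; first exact: rv_cst.
by apply: rvD => //; exact: rv_cst.
Qed.

Lemma expectation_opp_ge (e : R) X : H X -> E X = e%:E ->
  ((- e)%:E <= E (fun w => (- X w)%R))%E.
Proof.
move=> HX Ee.
have := expectation_subadd HX (rvN HX); rewrite Ee => /(_ isT).
rewrite (_ : (fun w => X w + - X w) = (fun=> 0)); last first.
  by apply/funext => w; rewrite subrr.
rewrite (sle_cst sle).
by rewrite -leeBlDl// sub0e.
Qed.

(** From [2 e Y <= Y ^+ 2 + e ^+ 2], since the left-hand side has expectation at
least [2 e ^+ 2] for either sign of [e]: for [e < 0], write it as
[(- 2 e) (- Y)] and use that the expectation of [- Y] is at least [- e]. *)
Lemma sqr_mean_le (e s : R) Y : H Y -> H (fun w => Y w ^+ 2) ->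
  E Y = e%:E -> E (fun w => Y w ^+ 2) = s%:E -> e ^+ 2 <= s.
Proof.
move=> HY HY2 Ee Es.
have up : (E (fun w => ((2 * e) * Y w)%R) <= (s + e ^+ 2)%:E)%E.
  rewrite EFinD -Es -expectation_shift ?Es//.
  apply: (sle_mono sle); [|exact: rvZ|].
    by apply: rvD => //; exact: rv_cst.
  by move=> w; have := sqr_ge0 (Y w - e); rewrite sqrrB => h; lra.
have [e0|/ltW e0] := leP 0 e.
  rewrite (sle_homog sle) ?mulr_ge0// Ee -EFinM lee_fin in up.
  by have := sqr_ge0 e; rewrite expr2 in up *; lra.
have low : (((- (2 * e)) * (- e))%:E <= E (fun w => ((2 * e) * Y w)%R))%E.
  rewrite (_ : (fun w => _) = (fun w => (- (2 * e)) * (- Y w))); last first.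
    by apply/funext => w; ring.
  rewrite (sle_homog sle) ?EFinM; [|lra|exact: rvN].
  apply: lee_pmul => //; rewrite ?lee_fin; [lra|lra|].
  exact: expectation_opp_ge.
by have := le_trans low up; rewrite lee_fin expr2; lra.
Qed.

Lemma centered_sqr_le (e s : R) Y : H Y -> H (fun w => Y w ^+ 2) ->
  E Y = e%:E -> E (fun w => Y w ^+ 2) = s%:E ->
  (E (fun w => ((Y w - e) ^+ 2)%R) <= (4 * s)%:E)%E.
Proof.
move=> HY HY2 Ee Es; have es := sqr_mean_le HY HY2 Ee Es.
have fin2 : E (fun w => 2 * Y w ^+ 2) \is a fin_num.
  by rewrite (sle_homog sle)// Es.
apply: (@le_trans _ _ (E (fun w => 2 * Y w ^+ 2 + 2 * e ^+ 2))).
  apply: (sle_mono sle).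
  - by apply: rvD; [exact: rvZ|exact: rv_cst].
  - rewrite (_ : (fun w => _) = (fun w => Y w ^+ 2 + ((- (2 * e)) * Y w + e ^+ 2))).
      by apply: rvD => //; apply: rvD; [exact: rvZ|exact: rv_cst].
    by apply/funext => w; ring.
  - by move=> w; have := sqr_ge0 (Y w + e); rewrite sqrrD sqrrB; lra.
rewrite expectation_shift//; last exact: rvZ.
by rewrite (sle_homog sle)// Es -EFinM -EFinD lee_fin; lra.
Qed.

Lemma capacity_ge0 (A : set Omega) : (0 <= upper_capacity H E A)%E.
Proof.
apply/ereal_infP => _ [xi [Hxi Axi] <-]; apply: expectation_ge0 => // w.
by apply: le_trans (Axi w); rewrite ler0n.
Qed.

Lemma le_capacity (A B : set Omega) : A `<=` B ->
  (upper_capacity H E A <= upper_capacity H E B)%E.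
Proof.
move=> AB; apply/ereal_infP => _ [xi [Hxi Bxi] <-].
apply: ge_ereal_inf; exists (E xi) => //; exists xi => //; split=> // w.
apply: le_trans (Bxi w).
rewrite !indicE ler_nat; case: (boolP (w \in A)) => // /set_mem/AB wB.
by rewrite mem_set.
Qed.

Lemma capacity_le_expectation (A : set Omega) xi : H xi -> (forall w, 0 <= xi w) ->
  (forall w, A w -> 1 <= xi w) -> (upper_capacity H E A <= E xi)%E.
Proof.
move=> Hxi xi0 xi1; apply: ge_ereal_inf; exists (E xi) => //; exists xi => //; split=> // w.
by rewrite indicE; case: (boolP (w \in A)) => // /set_mem/xi1.
Qed.

(** Freezing the past at [x] leaves [f x] times the expectation of [h (X k.+1)],
which is 0 because positive homogeneity applies to [f x >= 0].  The random
variable [Z] of the definition of independence is thus 0. *)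
Lemma independent_product (X : nat -> Omega -> R) (k : nat)
    (f : (nat -> R) -> R) (h : R -> R) :
  (forall n, H (X n)) -> independent_seq H E X ->
  lip_functional k.+1 f -> (forall u, 0 <= f u) ->
  lip_functional k.+2 (fun u => h (u k.+1)) ->
  E (fun w => h (X k.+1 w)) = 0%E ->
  E (fun w => f (fun j => X j w) * h (X k.+1 w)) = 0%E.
Proof.
move=> HX indX fk f0 hk Eh.
pose F (u : nat -> R) := f u * h (u k.+1).
have Fk : lip_functional (k.+1 + 1) F.
  by rewrite addn1; apply: lip_functionalM => //; exact: lip_functional_widen fk.
have Hh : H (fun w => h (X k.+1 w)) by exact: (rv_functional HX hk).
have low (x : 'rV[R]_k.+1) (y : 'rV[R]_1) j : (j < k.+1)%N ->
    seq_of_row (row_mx x y) j = seq_of_row x j.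
  move=> jk; rewrite (seq_of_rowE x (Ordinal jk)).
  by rewrite (seq_of_rowE _ (lshift 1 (Ordinal jk))) row_mxEl.
have top (x : 'rV[R]_k.+1) (y : 'rV[R]_1) :
    seq_of_row (row_mx x y) k.+1 = y ord0 ord0.
  have := seq_of_rowE (row_mx x y) (rshift k.+1 ord0).
  by rewrite row_mxEr /= addn0.
have eF (x : 'rV[R]_k.+1) (y : 'rV[R]_1) :
    F (seq_of_row (row_mx x y)) = f (seq_of_row x) * h (y ord0 ord0).
  rewrite /F top; congr (_ * _); apply: (lip_functional_local fk) => j jk.
  exact: low.
have phibar (x : 'rV[R]_k.+1) : E (fun w => F (seq_of_row
    (row_mx x (rvec (fun _ : 'I_1 => X k.+1) w)))) = 0%E.
  transitivity (E (fun w => f (seq_of_row x) * h (X k.+1 w))).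
    by congr E; apply/funext => w; rewrite eF mxE.
  by rewrite (sle_homog sle)// Eh mule0.
have : E (fun w => F (seq_of_row (row_mx (rvec (fun j : 'I_k.+1 => X j) w)
    (rvec (fun _ : 'I_1 => X k.+1) w)))) = E (fun=> 0).
  apply: (indX k _ (lip_functional_C_lLip Fk)) => [x|||].
  - by rewrite phibar ltry.
  - exact: rvs_zero.
  - by move=> w; rewrite phibar.
  - by under eq_fun do rewrite normr0; rewrite (sle_cst sle) ltry.
rewrite (sle_cst sle) => EF; rewrite -[RHS]EF; congr E; apply/funext => w.
rewrite eF mxE; congr (_ * _); apply: (lip_functional_local fk) => j jk.
by rewrite (seq_of_rowE _ (Ordinal jk)) mxE.
Qed.

End SublinearExpectation.

(** * The reflected walk and the maximal inequality *)

Section ReflectedWalk.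
Context {R : realType}.
Variables (g : nat -> R -> R) (m : nat).

Fixpoint reflected_walk (i : nat) (u : nat -> R) : R :=
  if i is i'.+1 then
    Num.max 0 (reflected_walk i' u + g (m + i') (u (m + i')%N))
  else 0.

Lemma reflected_walk_ge0 i u : 0 <= reflected_walk i u.
Proof. by case: i => //= i; rewrite le_max lexx. Qed.

(** The sum over a terminal segment is the position of a free walk started at 0 at
time [k], and reflection can only raise a walk. *)
Lemma tail_sum_le_reflected_walk i k (u : nat -> R) : (m <= k <= m + i)%N ->
  \sum_(k <= j < m + i) g j (u j) <= reflected_walk i u.
Proof.
elim: i => [|i IH] /=.
  by rewrite addn0 => km; rewrite big_geq//; case/andP: km.
rewrite addnS => /andP[mk]; rewrite leq_eqVlt => /predU1P[->|ki].
  by rewrite big_geq// le_max lexx.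
rewrite big_nat_recr//= le_max lerD2r IH ?orbT//.
by rewrite mk.
Qed.

Lemma lip_functional_reflected_walk i :
  (forall j, lip_functional j.+1 (fun u => g j (u j))) ->
  lip_functional (m + i) (reflected_walk i).
Proof.
move=> gL; elim: i => [|i IH] /=; first exact: lip_functional_cst.
apply: lip_functional_max0; rewrite addnS; apply: lip_functionalD => //.
exact: lip_functional_widen IH.
Qed.

Context {d : measure_display} {Omega : measurableType d}.
Variables (H : set (Omega -> R)) (E : (Omega -> R) -> \bar R).
Hypotheses (rvs : random_variable_space H) (sle : sublinear_expectation H E).
Variable X : nat -> Omega -> R.
Hypotheses (HX : forall n, H (X n)) (indX : independent_seq H E X).

(** Reflection at 0 can only lower the square of a step [a + b], and the cross term
of [(a + b) ^+ 2] has expectation 0 by independence. *)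
Lemma expectation_reflected_walk_sqr i :
  (forall j, lip_functional j.+1 (fun u => g j (u j))) ->
  (forall j, E (fun w => g j (X j w)) = 0%E) ->
  (E (fun w => (reflected_walk i (fun j => X j w) ^+ 2)%R) <=
   \sum_(m <= j < m + i) E (fun w => (g j (X j w) ^+ 2)%R))%E.
Proof.
move=> gL Eg; elim: i => [|i IH].
  rewrite addn0 big_geq//= (_ : (fun _ => _) = (fun=> 0)) ?(sle_cst sle)//.
  by apply/funext => _; rewrite expr0n.
rewrite addnS big_nat_recr ?leq_addr//=.
apply: le_trans (leeD2r _ IH).
set W := reflected_walk i.
set j := (m + i)%N.
have WL : lip_functional j W by exact: lip_functional_reflected_walk.
have WL1 : lip_functional j.+1 W by exact: lip_functional_widen WL.
have W2L : lip_functional j.+1 (fun u => W u ^+ 2).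
  by under eq_fun do rewrite expr2; exact: lip_functionalM.
have g2L : lip_functional j.+1 (fun u => g j (u j) ^+ 2).
  by under eq_fun do rewrite expr2; exact: lip_functionalM.
have cL : lip_functional j.+1 (fun u => W u * g j (u j)).
  exact: lip_functionalM.
have cross : E (fun w => W (fun j => X j w) * g j (X j w)) = 0%E.
  have jE : (m + i)%N = j by [].
  (* When j = 0 there is no past, but the walk has not left 0 yet. *)
  clearbody j; destruct j as [|k].
    have i0 : i = 0%N by apply/eqP; move/eqP: jE; rewrite addn_eq0 => /andP[].
    rewrite /W i0/= (_ : (fun _ => _) = (fun=> 0)) ?(sle_cst sle)//.
    by apply/funext => w; rewrite mul0r.
  apply: (independent_product rvs sle HX indX) => //.
  exact: reflected_walk_ge0.
have HW2 := rv_functional rvs HX W2L.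
have Hg2 := rv_functional rvs HX g2L.
have Hc := rv_functional rvs HX cL.
have E2c : E (fun w => 2 * (W (fun j => X j w) * g j (X j w))) = 0%E.
  by rewrite (sle_homog sle)// cross mule0.
have fin_W2 := expectation_functional_fin_num rvs sle HX W2L.
apply: (@le_trans _ _ (E (fun w => W (fun j => X j w) ^+ 2 +
    (2 * (W (fun j => X j w) * g j (X j w)) + g j (X j w) ^+ 2)))).
  apply: (sle_mono sle).
  - by apply: (rvD rvs) => //; apply: (rvD rvs) => //; exact: (rvZ rvs).
  - apply: (rv_functional rvs HX (N := j.+1) (f := fun u =>
      Num.max 0 (W u + g j (u j)) ^+ 2)).
    under eq_fun do rewrite expr2.
    by apply: lip_functionalM; apply: lip_functional_max0;
      apply: lip_functionalD.
  - move=> w; set a := W _; set b := g _ _.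
    have -> : a ^+ 2 + (2 * (a * b) + b ^+ 2) = (a + b) ^+ 2 by ring.
    by case: (leP 0 (a + b)) => // _; rewrite expr0n sqr_ge0.
apply: le_trans (expectation_subadd sle _ _ _) _ => //.
  by apply: (rvD rvs) => //; exact: (rvZ rvs).
rewrite leeD2l//.
apply: le_trans (expectation_subadd sle _ _ _) _ => //.
- exact: (rvZ rvs).
- by rewrite E2c.
- by rewrite E2c add0e.
Qed.

End ReflectedWalk.

Section MaximalInequality.
Context {R : realType} {d : measure_display} {Omega : measurableType d}.
Variables (H : set (Omega -> R)) (E : (Omega -> R) -> \bar R).
Hypotheses (rvs : random_variable_space H) (sle : sublinear_expectation H E).
Variable X : nat -> Omega -> R.
Hypotheses (HX : forall n, H (X n)) (indX : independent_seq H E X).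
Variable c : R.
Hypothesis c0 : 0 < c.
Let Y n w := truncation c id (X n w).
Variables e e' s : nat -> R.
Hypotheses (Ye : forall n, E (Y n) = (e n)%:E)
  (Ye' : forall n, E (fun w => - Y n w) = (e' n)%:E)
  (Ys : forall n, E (fun w => Y n w ^+ 2) = (s n)%:E).

Let HY n : H (Y n).
Proof. exact: (rv_functional rvs HX (lip_functional_clip n c0)). Qed.

Let HY2 n : H (fun w => Y n w ^+ 2).
Proof.
apply: (rv_functional rvs HX (N := n.+1) (f := fun u => truncation c id (u n) ^+ 2)).
under eq_fun do rewrite expr2.
by apply: lip_functionalM; exact: lip_functional_clip.
Qed.

Lemma reflected_walk_sqr_bound (h : R -> R) (a : nat -> R) m i :
  (forall j, lip_functional j.+1 (fun u => h (u j))) ->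
  (forall j, E (fun w => h (X j w)) = (a j)%:E) ->
  (forall j, E (fun w => h (X j w) ^+ 2) = (s j)%:E) ->
  (E (fun w => (reflected_walk (fun j x => h x - a j) m i (fun j => X j w) ^+ 2)%R)
   <= (4 * \sum_(m <= j < m + i) s j)%:E)%E.
Proof.
move=> hL Ea Es.
have gL j : lip_functional j.+1 (fun u => h (u j) - a j).
  by apply: lip_functionalD => //; exact: lip_functional_cst.
have Hh j : H (fun w => h (X j w)) by exact: (rv_functional rvs HX (hL j)).
have Hh2 j : H (fun w => h (X j w) ^+ 2).
  apply: (rv_functional rvs HX (N := j.+1) (f := fun u => h (u j) ^+ 2)).
  by under eq_fun do rewrite expr2; exact: lip_functionalM.
apply: le_trans (expectation_reflected_walk_sqr _ rvs sle HX indX _ gL _) _.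
  move=> j; rewrite (expectation_shift rvs sle)//; rewrite Ea//.
  by rewrite -EFinD subrr.
rewrite mulr_sumr -sumEFin; apply: lee_sum => j _.
exact: (centered_sqr_le rvs sle).
Qed.

(** An initial sum is the difference of two terminal sums, and each of these lies
between [- (Q + eps / 4)] and [P + eps / 4] for the walks [P] and [Q] driven by the
centred [Y] and [- Y].  So a large initial sum forces [P + Q > eps / 2], whence
[8 / eps ^+ 2 * (P ^+ 2 + Q ^+ 2) >= 1]. *)
Lemma capacity_block_le (eps : R) m i : 0 < eps ->
  (forall k, (m <= k <= m + i)%N -> `|\sum_(k <= j < m + i) e j| <= eps / 4) ->
  (forall k, (m <= k <= m + i)%N -> `|\sum_(k <= j < m + i) e' j| <= eps / 4) ->
  (upper_capacity H E [set w | exists2 k, (m <= k <= m + i)%N &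
      (eps < `|\sum_(m <= j < k) Y j w|)%R]
   <= (64 / eps ^+ 2 * \sum_(m <= j < m + i) s j)%:E)%E.
Proof.
move=> eps0 se se'.
pose h x := truncation c id x.
have hL j : lip_functional j.+1 (fun u => h (u j)) by exact: lip_functional_clip.
have nhL j : lip_functional j.+1 (fun u => - h (u j)) by exact: lip_functionalN.
pose P w := reflected_walk (fun j x => h x - e j) m i (fun j => X j w).
pose Q w := reflected_walk (fun j x => - h x - e' j) m i (fun j => X j w).
have EP : (E (fun w => (P w ^+ 2)%R) <= (4 * \sum_(m <= j < m + i) s j)%:E)%E.
  exact: reflected_walk_sqr_bound.
have EQ : (E (fun w => (Q w ^+ 2)%R) <= (4 * \sum_(m <= j < m + i) s j)%:E)%E.
  apply: (@reflected_walk_sqr_bound (fun x => - h x)) => // j.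
  by under eq_fun do rewrite sqrrN; exact: Ys.
have walk_sqr (h' : R -> R) (a : nat -> R) :
    (forall j, lip_functional j.+1 (fun u => h' (u j))) ->
    lip_functional (m + i)
      (fun u => reflected_walk (fun j x => h' x - a j) m i u ^+ 2).
  move=> h'L; under eq_fun do rewrite expr2.
  by apply: lip_functionalM; apply: lip_functional_reflected_walk => j;
    apply: lip_functionalD => //; exact: lip_functional_cst.
have HP := rv_functional rvs HX (walk_sqr _ e hL).
have HQ := rv_functional rvs HX (walk_sqr (fun x => - h x) e' nhL).
have fP := expectation_functional_fin_num rvs sle HX (walk_sqr _ e hL).
have K0 : 0 <= 8 / eps ^+ 2 by rewrite divr_ge0 ?sqr_ge0.
apply: (@le_trans _ _ (E (fun w => 8 / eps ^+ 2 * (P w ^+ 2 + Q w ^+ 2)))).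
  apply: capacity_le_expectation => //.
  - by apply: (rvZ rvs); exact: (rvD rvs).
  - by move=> w; rewrite mulr_ge0// addr_ge0 ?sqr_ge0.
  move=> w [k /[dup] kmi /andP[mk ki]] big.
  have tail l : (m <= l <= m + i)%N ->
      - (Q w + eps / 4) <= \sum_(l <= j < m + i) Y j w <= P w + eps / 4.
    move=> lmi.
    have := tail_sum_le_reflected_walk (fun j x => h x - e j) (fun j => X j w) lmi.
    have := tail_sum_le_reflected_walk (fun j x => - h x - e' j) (fun j => X j w) lmi.
    rewrite -/(P w) -/(Q w) !sumrB sumrN.
    have := se _ lmi; have := se' _ lmi; rewrite !ler_norml.
    rewrite /h -/(Y _ _); set a := \sum_(_ <= _ < _) e _; set b := \sum_(_ <= _ < _) e' _.
    move=> /andP[? ?] /andP[? ?] ? ?; rewrite /Y; apply/andP; split; lra.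
  have mm : (m <= m <= m + i)%N by rewrite leqnn leq_addr.
  have := tail _ kmi; have := tail _ mm.
  rewrite (big_cat_nat mk ki)/= => /andP[? ?] /andP[? ?].
  have PQ : eps / 2 < P w + Q w.
    by move: big; rewrite ltNge ler_norml => /negP big;
      rewrite ltNge; apply/negP => h1; apply: big; apply/andP; split; lra.
  rewrite mulrAC ler_pdivlMr ?exprn_gt0// mul1r.
  have : (eps / 2) ^+ 2 <= (P w + Q w) ^+ 2.
    by rewrite ler_sqr ?nnegrE; lra.
  have := sqr_ge0 (P w - Q w); rewrite !expr2; lra.
rewrite (sle_homog sle)//; last exact: (rvD rvs).
set S := \sum_(m <= j < m + i) s j in EP EQ *.
rewrite [X in (_ <= X)%E](_ : _ =
    (8 / eps ^+ 2)%:E * ((4 * S)%:E + (4 * S)%:E))%E; last first.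
  by rewrite -EFinD -EFinM; congr EFin; ring.
apply: lee_wpmul2l; first by rewrite lee_fin.
apply: le_trans (leeD EP EQ).
exact: (expectation_subadd sle).
Qed.

End MaximalInequality.

(** * Convergence of series through block sums *)

Section SeriesTails.
Context {R : realType}.
Implicit Types u : nat -> R.

Lemma cvg_series_tailP u : cvgn (series u) <->
  forall eps : R, 0 < eps -> exists N, forall m n, (N <= m)%N -> (m <= n)%N ->
    `|\sum_(m <= j < n) u j| <= eps.
Proof.
split=> [/cauchy_cvgP/cauchy_seriesP cu eps eps0|cu].
  have [[A B] [[N1 _ N1A] [N2 _ N2B]] AB] := cu eps eps0.
  exists (maxn N1 N2) => m n; rewrite geq_max => /andP[Nm Nm'] mn.
  apply: ltW; apply: (AB (m, n)); split; first exact: N1A.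
  by apply: N2B => /=; exact: leq_trans mn.
apply/cauchy_cvgP/cauchy_seriesP => eps eps0.
have [N NP] := cu _ (divr_gt0 eps0 (ltr0n _ 2)).
exists ([set n | (N <= n)%N], [set n | (N <= n)%N]); first by split; exists N.
move=> [m n] [/= Nm Nn]; have [mn|/ltnW nm] := leqP m n.
  by apply: le_lt_trans (NP m n Nm mn) _; lra.
by rewrite big_geq// normr0.
Qed.

Lemma ereal_series_converges_cvg u :
  ereal_series_converges (fun n => (u n)%:E) -> cvgn (series u).
Proof.
move=> [l ul]; apply/cvg_ex; exists l.
rewrite (_ : series u = fine \o (fun n => \sum_(0 <= k < n) (u k)%:E)%E).
  exact: fine_cvg.
by apply/funext => n /=; rewrite sumEFin.
Qed.

Lemma nneseries_lty_cvg u : (forall n, 0 <= u n) ->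
  (\sum_(0 <= n <oo) (u n)%:E < +oo)%E -> cvgn (series u).
Proof.
move=> u0 uoo; apply: ereal_series_converges_cvg.
have pos n : (0 <= n)%N -> true -> (0 <= (u n)%:E)%E by rewrite lee_fin.
have fin : (\sum_(0 <= n <oo) (u n)%:E)%E \is a fin_num.
  by rewrite ge0_fin_numE// nneseries_ge0.
exists (fine (\sum_(0 <= n <oo) (u n)%:E)%E); rewrite fineK//.
exact: is_cvg_nneseries.
Qed.

Lemma cvg_series_eventually_eq u v : (exists N, forall n, (N <= n)%N -> u n = v n) ->
  cvgn (series u) -> cvgn (series v).
Proof.
move=> [N uv] /cvg_series_tailP cu; apply/cvg_series_tailP => eps /cu[M MP].
exists (maxn M N) => m n; rewrite geq_max => /andP[Mm Nm] mn.
rewrite -(@eq_big_nat _ _ _ m n u); first exact: MP.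
by move=> j /andP[mj _]; apply: uv; exact: leq_trans mj.
Qed.

(** The bounds on the blocks after the [p]-th add up to the bound on the [p]-th, so
all sums starting at [b p] are at most twice that bound. *)
Lemma cvg_series_blocks u (b : nat -> nat) J : (forall p, (b p < b p.+1)%N) ->
  (forall p, (J <= p)%N -> forall k, (b p <= k <= b p.+1)%N ->
    `|\sum_(b p <= j < k) u j| <= 1 / (2 ^ p.+1)%:R) ->
  cvgn (series u).
Proof.
move=> bS ub.
have b_ge p n : (n <= b (p + n))%N.
  by elim: n => // n IH; rewrite addnS; exact: leq_ltn_trans (bS _).
have half p : 1 / (2 ^ p.+1)%:R = 1 / (2 ^ p.+2)%:R + 1 / (2 ^ p.+2)%:R :> R.
  have : ((2 ^ p.+1)%N%:R : R) != 0 by rewrite pnatr_eq0 expn_eq0.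
  by rewrite (expnS 2 p.+1) natrM => h; field.
have step D p k : (J <= p)%N -> (b p <= k <= b (p + D))%N ->
    `|\sum_(b p <= j < k) u j| <= 2 * (1 / (2 ^ p.+1)%:R).
  elim: D p => [|D IH] p Jp /andP[pk kp].
    by rewrite addn0 in kp; rewrite big_geq// normr0 mulr_ge0 ?divr_ge0.
  have [kp1|/ltnW p1k] := leqP k (b p.+1).
    apply: le_trans (ub p Jp k _) _; first by rewrite pk.
    by rewrite ler_peMl ?ler1n// divr_ge0.
  rewrite (big_cat_nat (ltnW (bS p)) p1k)/=.
  apply: le_trans (ler_normD _ _) _; rewrite mulrDl mul1r.
  apply: lerD; first by apply: ub => //; rewrite leqnn ltnW.
  rewrite half; apply: le_trans (IH p.+1 _ _) _; first exact: leqW.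
    by rewrite p1k addSnnS.
  by lra.
apply/cvg_series_tailP => eps eps0.
have e4 : 0 < eps / 4 by rewrite divr_gt0.
have [N0 _ N0P] := near_infty_natSinv_expn_lt (PosNum e4).
pose p := maxn J N0.
have pe : 1 / (2 ^ p.+1)%:R <= eps / 4.
  have := N0P p (leq_maxr _ _); rewrite /= => /ltW; apply: le_trans.
  rewrite !div1r natrX lef_pV2 ?posrE ?exprn_gt0//.
  by apply: ler_weXn2l => //; rewrite ler1n.
have Jp : (J <= p)%N by exact: leq_maxl.
exists (b p) => m n pm mn.
have h1 : `|\sum_(b p <= j < n) u j| <= eps / 2.
  apply: le_trans (step n p n Jp _) _; first by rewrite b_ge (leq_trans pm).
  by lra.
have h2 : `|\sum_(b p <= j < m) u j| <= eps / 2.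
  apply: le_trans (step m p m Jp _) _; first by rewrite b_ge pm.
  by lra.
move: h1 h2; rewrite (big_cat_nat pm mn)/= !ler_norml => /andP[? ?] /andP[? ?].
by apply/andP; split; lra.
Qed.

End SeriesTails.

Lemma measurable_block_sum_le (R : realType) (d : measure_display)
    (Omega : measurableType d) (X : nat -> Omega -> R) (m n : nat) (a : R) :
  (forall n, measurable_fun setT (X n)) ->
  measurable [set w | `|\sum_(m <= j < n) X j w| <= a].
Proof.
move=> mX; rewrite -[X in measurable X]setTI; apply: measurable_fun_le => //.
by apply: measurableT_comp => //; exact: measurable_sum.
Qed.

Lemma measurable_not_cvg_series (R : realType) (d : measure_display)
    (Omega : measurableType d) (X : nat -> Omega -> R) :
  (forall n, measurable_fun setT (X n)) ->
  measurable [set w | ~ cvgn (series (fun n => X n w))].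
Proof.
move=> mX.
pose small p m n : set Omega := [set w | `|\sum_(m <= j < n) X j w| <= p.+1%:R^-1].
rewrite (_ : [set w | _] = ~` (\bigcap_p \bigcup_N
    \bigcap_(m in [set m | (N <= m)%N]) \bigcap_(n in [set n | (m <= n)%N])
      small p m n)).
  apply: measurableC; apply: bigcap_measurableType => p _.
  apply: bigcup_measurable => N _; apply: bigcap_measurableType => m _.
  apply: bigcap_measurableType => n _.
  exact: measurable_block_sum_le.
congr (~` _); apply/seteqP; split=> w /= h; last first.
  apply/cvg_series_tailP => eps eps0.
  have [p _ pP] := near_infty_natSinv_lt (PosNum eps0).
  have [N _ NP] := h p I; exists N => m n Nm mn.
  by apply: le_trans (NP m Nm n mn) _; exact: ltW (pP p (leqnn p)).
move=> p _; move/cvg_series_tailP : h => /(_ p.+1%:R^-1).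
by rewrite invr_gt0 ltr0n => /(_ isT)[N NP]; exists N => // m Nm n mn; exact: NP.
Qed.

(** * Null sets of countably sub-additive capacities *)

Section BorelCantelli.
Context {R : realType} {d : measure_display} {Omega : measurableType d}.
Variable V : set Omega -> \bar R.
Hypotheses (V_ge0 : forall A, (0 <= V A)%E)
  (le_V : forall A B, A `<=` B -> (V A <= V B)%E)
  (csubV : countably_subadditive V).

Lemma capacity_lim_sup_set (A : nat -> set Omega) :
  (forall n, measurable (A n)) -> (\sum_(0 <= n <oo) V (A n) < +oo)%E ->
  V (lim_sup_set A) = 0%E.
Proof.
move=> mA Aoo; apply/eqP; rewrite eq_le V_ge0 andbT.
have tail0 := @nneseries_tail_cvg _ _ xpredT Aoo (fun n _ => V_ge0 (A n)).
rewrite -(cvg_lim _ tail0)//; apply: lime_ge; first by apply/cvg_ex; exists 0%E.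
apply: nearW => N; rewrite -(nneseries_addn N (fun n => V_ge0 (A n))).
apply: le_trans (csubV (A := fun n => A (n + N)%N) (fun n => mA _)).
apply: le_V => w /(_ N I)[n /= Nn An]; exists (n - N)%N => //=.
by rewrite subnK.
Qed.

Lemma capacity_setU0 (A B : set Omega) : measurable A -> measurable B ->
  V A = 0%E -> V B = 0%E -> V (A `|` B) = 0%E.
Proof.
move=> mA mB A0 B0; apply/eqP; rewrite eq_le V_ge0 andbT.
pose C n := if n is 0%N then A else B.
apply: (@le_trans _ _ (V (\bigcup_n C n))).
  by apply: le_V => w [Aw|Bw]; [exists 0%N|exists 1%N].
apply: le_trans (csubV (A := C) _) _; first by case.
by rewrite eseries0// => -[|n] _ _.
Qed.

(** Only finite blocks are controlled, but with a bound that does not depend on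
their length; hence the starting point of a block can be chosen first, and its
end as the starting point of the next one. *)
Lemma capacity_not_cvg_series (Y : nat -> Omega -> R) :
  (forall n, measurable_fun setT (Y n)) ->
  (forall eps : R, 0 < eps -> exists M, forall m i, (M <= m)%N ->
    (V [set w | exists2 k, (m <= k <= m + i)%N &
      (eps < `|\sum_(m <= j < k) Y j w|)%R] <= eps%:E)%E) ->
  V [set w | ~ cvgn (series (fun n => Y n w))] = 0%E.
Proof.
move=> mY blk.
pose delta p : R := 1 / (2 ^ p.+1)%:R.
have delta_gt0 p : 0 < delta p by rewrite divr_gt0// ltr0n expn_gt0.
have [M MP] := choice (fun p => blk _ (delta_gt0 p)).
pose b := fix b p := if p is p'.+1 then maxn (b p').+1 (M p) else M 0%N.
have bS p : (b p < b p.+1)%N by exact: leq_maxl.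
have Mb p : (M p <= b p)%N by case: p => //= p; exact: leq_maxr.
pose A p := [set w | exists2 k, (b p <= k <= b p.+1)%N &
  delta p < `|\sum_(b p <= j < k) Y j w|].
have mA p : measurable (A p).
  rewrite (_ : A p = \bigcup_(k in [set k | (b p <= k <= b p.+1)%N])
      [set w | delta p < `|\sum_(b p <= j < k) Y j w|]); last first.
    by apply/seteqP; split=> w [k kb wk]; exists k.
  apply: bigcup_measurable => k _.
  have := measurableC (measurable_block_sum_le (b p) k (delta p) mY).
  congr measurable; apply/seteqP; split=> w /=; rewrite ltNge => /negP//.
have VA p : (V (A p) <= (delta p)%:E)%E.
  by have := MP p (b p) (b p.+1 - b p)%N (Mb p); rewrite subnKC// ltnW.
have A0 : V (lim_sup_set A) = 0%E.
  apply: capacity_lim_sup_set => //.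
  apply: (@le_lt_trans _ _ (\sum_(0 <= p <oo) (delta p)%:E)%E).
    by apply: lee_nneseries => // p _; exact: V_ge0.
  by apply: le_lt_trans (epsilon_trick0 _ ler01) _; rewrite ltry.
apply/eqP; rewrite eq_le V_ge0 andbT -A0; apply: le_V => w ncvg J _.
apply: contrapT => nA; apply: ncvg; apply: (@cvg_series_blocks _ _ b J) => //.
move=> p Jp k kb; rewrite leNgt; apply/negP => big; apply: nA.
by exists p => //; exists k.
Qed.

End BorelCantelli.

(** * Almost sure convergence *)

Lemma truncation_id_sqr_le (R : realType) (c q x : R) : 0 < c -> 1 <= q <= 2 ->
  truncation c id x ^+ 2 <= c `^ (2 - q) * `|truncation c id x| `^ q.
Proof.
move=> c0 /andP[q1 q2]; set y := truncation c id x.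
have yc : `|y| <= c by exact: truncation_id_bound.
rewrite -real_normK ?num_real// -powR_mulrn//.
have -> : `|y| `^ 2%:R = `|y| `^ (2 - q) * `|y| `^ q.
  by rewrite -powRD subrK// pnatr_eq0.
rewrite ler_wpM2r ?powR_ge0//.
by apply: ge0_ler_powR; rewrite ?nnegrE ?(ltW c0)//; lra.
Qed.

Lemma not_lim_sup_set (T : Type) (A : nat -> set T) (w : T) :
  ~ lim_sup_set A w -> exists N, forall n, (N <= n)%N -> ~ A n w.
Proof.
move=> nA; apply: contrapT => h; apply: nA => N _; apply: contrapT => hN.
by apply: h; exists N => n Nn An; apply: hN; exists n.
Qed.

Lemma truncation_id_small (R : realType) (c x : R) :
  0 < c -> `|x| <= c -> truncation c id x = x.
Proof.
move=> c0; rewrite ler_norml => /andP[cx xc].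
by rewrite truncation_idE// ltNge cx xc.
Qed.

Theorem corollary3p1 (R : realType) (d : measure_display)
    (Omega : measurableType d) (H : set (Omega -> R))
    (E : (Omega -> R) -> \bar R) (X : nat -> Omega -> R) (c q : R) :
  sublinear_expectation_space H E ->
  countably_subadditive (upper_capacity H E) ->
  (forall n, H (X n)) ->
  independent_seq H E X ->
  0 < c ->
  (\sum_(0 <= n <oo) upper_capacity H E [set w | (c < `|X n w|)%R] < +oo)%E ->
  ereal_series_converges (fun n => E (truncation c (X n))) ->
  ereal_series_converges (fun n => conj_expectation E (truncation c (X n))) ->
  1 <= q <= 2 ->
  (\sum_(0 <= n <oo) E (fun w => (`|truncation c (X n) w| `^ q)%R) < +oo)%E ->
  almost_surely (upper_capacity H E)
    (fun w => cvgn (series (fun n => X n w))).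
Proof.
move=> [rvs sle] csub HX indX c0 sumV sumE sumE' q12 sumq.
have V0 := capacity_ge0 rvs sle.
have leV := @le_capacity _ _ _ H E.
pose Y n w := truncation c id (X n w).
have YL n : lip_functional n.+1 (fun u : nat -> R => truncation c id (u n)).
  exact: lip_functional_clip.
have Y2L n : lip_functional n.+1 (fun u : nat -> R => truncation c id (u n) ^+ 2).
  by under eq_fun do rewrite expr2; exact: lip_functionalM.
have NYL n : lip_functional n.+1 (fun u : nat -> R => - truncation c id (u n)).
  exact: lip_functionalN.
have YqL n : lip_functional n.+1
    (fun u : nat -> R => `|truncation c id (u n)| `^ q).
  exact: lip_functional_clip_powR.
have HY n : H (Y n) := rv_functional rvs HX (YL n).
have HYq n : H (fun w => `|Y n w| `^ q) := rv_functional rvs HX (YqL n).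
have HY2 n : H (fun w => Y n w ^+ 2) := rv_functional rvs HX (Y2L n).
pose e n := fine (E (Y n)).
pose e' n := fine (E (fun w => - Y n w)).
pose s n := fine (E (fun w => Y n w ^+ 2)).
pose r n := fine (E (fun w => `|Y n w| `^ q)).
have Ee n : E (Y n) = (e n)%:E.
  by rewrite fineK//; exact (expectation_functional_fin_num rvs sle HX (YL n)).
have Ee' n : E (fun w => - Y n w) = (e' n)%:E.
  by rewrite fineK//; exact (expectation_functional_fin_num rvs sle HX (NYL n)).
have Es n : E (fun w => Y n w ^+ 2) = (s n)%:E.
  by rewrite fineK//; exact (expectation_functional_fin_num rvs sle HX (Y2L n)).
have Er n : E (fun w => `|Y n w| `^ q) = (r n)%:E.
  by rewrite fineK//; exact (expectation_functional_fin_num rvs sle HX (YqL n)).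
have cvg_e : cvgn (series e).
  apply: ereal_series_converges_cvg; move: sumE; congr ereal_series_converges.
  by apply/funext => n; rewrite -Ee.
have cvg_e' : cvgn (series e').
  rewrite -is_cvg_seriesN; apply: ereal_series_converges_cvg; move: sumE'.
  congr ereal_series_converges; apply/funext => n.
  by rewrite EFinN -Ee'.
have r0 n : 0 <= r n.
  by rewrite -lee_fin -Er (expectation_ge0 rvs sle)// => w; exact: powR_ge0.
have s0 n : 0 <= s n.
  by rewrite -lee_fin -Es (expectation_ge0 rvs sle)// => w; exact: sqr_ge0.
have cvg_r : cvgn (series r).
  apply: nneseries_lty_cvg => //.
  by rewrite (eq_eseriesr (g := fun n => E (fun w => `|Y n w| `^ q))).
have cvg_s : cvgn (series s).
  apply: (@series_le_cvg _ _ (fun n => c `^ (2 - q) * r n)) => //.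
  - by move=> n; rewrite mulr_ge0// powR_ge0.
  - move=> n; rewrite -lee_fin EFinM -Er -Es -(sle_homog sle) ?powR_ge0//.
    apply: (sle_mono sle) => // [|w]; first exact: (rvZ rvs).
    exact: truncation_id_sqr_le.
  - exact: is_cvg_seriesZ.
have mX n : measurable_fun setT (X n) := rvs_measurable rvs (HX n).
have mY n : measurable_fun setT (Y n) := rvs_measurable rvs (HY n).
have Ynull : upper_capacity H E [set w | ~ cvgn (series (fun n => Y n w))] = 0%E.
  apply: capacity_not_cvg_series => // eps eps0.
  have e4 : 0 < eps / 4 by rewrite divr_gt0.
  (* The maximal inequality turns this bound on the second moments into eps. *)
  have e64 : 0 < eps ^+ 3 / 64 by rewrite divr_gt0 ?exprn_gt0.
  have [Ne NeP] := (cvg_series_tailP e).1 cvg_e _ e4.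
  have [Ne' Ne'P] := (cvg_series_tailP e').1 cvg_e' _ e4.
  have [Ns NsP] := (cvg_series_tailP s).1 cvg_s _ e64.
  exists (maxn Ne (maxn Ne' Ns)) => m i; rewrite !geq_max => /and3P[me me' ms].
  apply: le_trans (capacity_block_le rvs sle HX indX c0 Ee Ee' Es eps0 _ _) _.
  - by move=> k /andP[mk ki]; apply: NeP => //; exact: leq_trans mk.
  - by move=> k /andP[mk ki]; apply: Ne'P => //; exact: leq_trans mk.
  rewrite lee_fin.
  have := NsP m (m + i)%N ms (leq_addr _ _); rewrite ger0_norm ?sumr_ge0// => le_s.
  apply: (@le_trans _ _ (64 / eps ^+ 2 * (eps ^+ 3 / 64))).
    by rewrite ler_wpM2l// divr_ge0// sqr_ge0.
  suff -> : 64 / eps ^+ 2 * (eps ^+ 3 / 64) = eps by [].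
  by field; rewrite gt_eqF.
have mBig n : measurable [set w | c < `|X n w|].
  have := measurableC (measurable_block_sum_le n n.+1 c mX).
  congr measurable; apply/seteqP; split=> w /=; rewrite big_nat1 ltNge => /negP//.
split; first exact: measurable_not_cvg_series.
apply/eqP; rewrite eq_le V0 andbT.
rewrite -(capacity_setU0 V0 leV csub
  (A := lim_sup_set (fun n => [set w | c < `|X n w|]))
  (B := [set w | ~ cvgn (series (fun n => Y n w))]))//.
- apply: leV => w ncvg; apply: contrapT.
  move=> /not_orP[nbig /contrapT cvgY].
  have [N NP] := not_lim_sup_set nbig.
  apply: ncvg; apply: cvg_series_eventually_eq cvgY.
  exists N => n Nn; apply: truncation_id_small => //.
  by rewrite leNgt; apply/negP; exact: NP.
- apply: bigcap_measurableType => N _; apply: bigcup_measurable => n _.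
  exact: mBig.
- exact: measurable_not_cvg_series.
- exact: capacity_lim_sup_set.
Qed.
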